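(* For every $n\ge 1$, $$\sum_{P\in\mathcal D_n} q^{\mathrm{speaks}\,P}\,t^{\mathrm{npeaks}\,P}=\sum_{P\in\mathcal D_n} q^{\mathrm{stunnels}\,P}\,t^{\,n-\mathrm{des}\,P}.$$
   Context: $\mathcal D_n$ is the set of Dyck paths of semilength $n$: words $s_1\ldots s_{2n}$ with $n$ letters $U$ (step $(1,1)$) and $n$ letters $D$ (step $(1,-1)$) such that every prefix has at least as many $U$'s as $D$'s; viewed as lattice paths from $(0,0)$ to $(2n,0)$ staying weakly above the $x$-axis. A peak is a factor $s_is_{i+1}=UD$, with height $\mathrm{ht}(p)=\#\{j\le i:s_j=U\}-\#\{j\le i:s_j=D\}$ (the $y$-coordinate of its top point); $\mathrm{npeaks}\,P$ is the number of peaks and $\mathrm{speaks}\,P=\sum_p(\mathrm{ht}(p)-1)$ over all peaks. A valley is a factor $s_js_{j+1}=DU$; $\mathrm{des}\,P$ is the number of valleys. For a valley $v$ whose lowest lattice point is $(x_v,h_v)$, let $x'_v$ be the largest $x<x_v$ such that the path passes through $(x,h_v)$; the tunnel of $v$ has semilength $(x_v-x'_v)/2$, and $\mathrm{stunnels}\,P$ is the sum of the semilengths of the tunnels of all valleys of $P$. *)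

(* Defs.v *)
From mathcomp Require Import all_boot all_order all_algebra.

Set Implicit Arguments.
Unset Strict Implicit.
Unset Printing Implicit Defensive.

Notation up := true (only parsing).
Notation down := false (only parsing).

Definition is_dyck (n : nat) (s : seq bool) : bool :=
  [&& count_mem up s == n, count_mem down s == n
    & [forall i : 'I_(size s).+1,
         count_mem down (take i s) <= count_mem up (take i s)]].

Definition Dyck (n : nat) : {set n.*2.-tuple bool} :=
  [set s : n.*2.-tuple bool | is_dyck n s].

(* The y-coordinate of the lattice point of abscissa x; on Dyck words the     *)
(* subtraction is never truncated.                                            *)
Definition height (s : seq bool) (x : nat) : nat :=
  count_mem up (take x s) - count_mem down (take x s).

(* Peaks and valleys are identified with the abscissa of their extremal       *)
(* point, which lies between the letters of (0-based) index x.-1 and x.       *)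
Definition is_peak (s : seq bool) (x : nat) : bool :=
  [&& 0 < x, x < size s, nth down s x.-1 == up & nth down s x == down].

Definition is_valley (s : seq bool) (x : nat) : bool :=
  [&& 0 < x, x < size s, nth down s x.-1 == down & nth down s x == up].

Definition npeaks (s : seq bool) : nat :=
  \sum_(x < size s | is_peak s x) 1.

Definition speaks (s : seq bool) : nat :=
  \sum_(x < size s | is_peak s x) (height s x - 1).

Definition des (s : seq bool) : nat :=
  \sum_(x < size s | is_valley s x) 1.

(* For a valley x of a Dyck path this maximum is over a nonempty set: the     *)
(* path starts at height 0 and enters the valley from above.                  *)
Definition tunnel_start (s : seq bool) (x : nat) : nat :=
  \max_(y < x | height s y == height s x) y.

Definition tunnel_semilength (s : seq bool) (x : nat) : nat :=
  (x - tunnel_start s x)./2.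

Definition stunnels (s : seq bool) : nat :=
  \sum_(x < size s | is_valley s x) tunnel_semilength s x.

(* Main.v *)
Require Import Defs.
From mathcomp Require Import all_boot all_order all_algebra.
From mathcomp Require Import zify ring.

Set Implicit Arguments.
Unset Strict Implicit.
Unset Printing Implicit Defensive.

(* Cutting a Dyck path at its first return, P = U A D B, gives for the
   generating functions L(x,t) and R(x,t) of the two sides
     L(x,t) = 1 + x (L(x,qt) - 1 + t) L(x,t),
     R(x,t) = 1 + x t R(x,t) + x q R(qx,t) (R(x,t) - 1).
   The first equation determines L, so it suffices that R satisfies it, that
   is, that D(x) := (R(x,qt) - 1) R(x,t) - q R(qx,t) (R(x,t) - 1) vanishes.
   The equation for R implies
     (1 - x q R(qx,t)) D(x) = x q R(x,t) (R(x,qt) - 1) D(qx),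
   which makes the coefficients of D in x vanish one after the other. *)

(** * First-return decomposition of Dyck words *)

(** Words that lead from height [h] down to 0 without passing below the axis. The free starting
    height makes the Dyck condition structurally recursive. *)
Fixpoint dyck_from (h : nat) (s : seq bool) : bool :=
  match s with
  | [::] => h == 0
  | true :: s' => dyck_from h.+1 s'
  | false :: s' => if h is h'.+1 then dyck_from h' s' else false
  end.

Definition node (a b : seq bool) : seq bool := true :: a ++ false :: b.

(* Fixing the type to [seq bool], rather than [Equality.sort bool] as
   [count_mem] does, keeps the atoms seen by [lia] syntactically equal. *)
Definition nb (b : bool) (s : seq bool) : nat := count_mem b s.
Arguments nb : simpl never.

Lemma nb_nil b : nb b [::] = 0.
Proof. by []. Qed.

Lemma nb_cons b c s : nb b (c :: s) = (c == b) + nb b s.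
Proof. by []. Qed.

Lemma nb_cat b s1 s2 : nb b (s1 ++ s2) = nb b s1 + nb b s2.
Proof. exact: count_cat. Qed.

Lemma size_nb s : size s = nb true s + nb false s.
Proof. by elim: s => [|[] s IH]; rewrite /= ?IH ?(nb_nil, nb_cons); lia. Qed.

Lemma dyck_from_nb h s : dyck_from h s -> nb false s = h + nb true s.
Proof.
elim: s h => [|[] s IH] [|h] //= /IH; rewrite ?(nb_nil, nb_cons); lia.
Qed.

Lemma dyck_from_prefix h s i :
  dyck_from h s -> nb false (take i s) <= h + nb true (take i s).
Proof.
elim: s h i => [|[] s IH] [|h] [|i] //= H; have := IH _ i H; rewrite ?(nb_nil, nb_cons); lia.
Qed.

Lemma prefixes_dyck_from h s :
  nb false s = h + nb true s ->
  (forall i, i <= size s ->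
     nb false (take i s) <= h + nb true (take i s)) ->
  dyck_from h s.
Proof.
elim: s h => [|b s IH] h; first by rewrite /nb /= addn0 => <-.
case: b; rewrite !nb_cons => Hc Hp /=.
  apply: IH => [|i Hi]; first lia.
  by have := Hp i.+1 Hi; rewrite /= !nb_cons; lia.
case: h Hc Hp => [|h] Hc Hp; first by have := Hp 1 isT; rewrite /= take0.
apply: IH => [|i Hi]; first lia.
by have := Hp i.+1 Hi; rewrite /= !nb_cons; lia.
Qed.

Lemma is_dyckE n s : is_dyck n s = (size s == n.*2) && dyck_from 0 s.
Proof.
apply/and3P/andP => [[/eqP Hu /eqP Hd /forallP Hp]|[/eqP Hs Hd]].
  split; first by rewrite size_nb /nb Hu Hd addnn.
  apply: prefixes_dyck_from => [|i Hi]; first by rewrite /nb Hu Hd.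
  exact: (Hp (Ordinal (Hi : i < (size s).+1))).
have Hc := dyck_from_nb Hd; move: Hs; rewrite size_nb => Hs.
split; [apply/eqP; rewrite -/(nb _ _); lia..|].
by apply/forallP => i; exact: (dyck_from_prefix i Hd).
Qed.

Lemma dyck_from_cat k h a b :
  dyck_from k a -> dyck_from (k + h) (a ++ b) = dyck_from h b.
Proof.
elim: a k => [|[] a IH] [|k] //=; rewrite -?addSn; exact: IH.
Qed.

Lemma dyck_node a b : dyck_from 0 a -> dyck_from 0 b -> dyck_from 0 (node a b).
Proof. by move=> Ha Hb; rewrite /= (dyck_from_cat (k := 0) 1 _ Ha). Qed.

(** The [D] singled out is the first step below the starting level. After a leading [U] the tail is
    split twice, once for each level to descend, and the first two pieces form [node a a']; the
    second split is of a suffix, hence the induction on length. *)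
Lemma dyck_from_split h s : dyck_from h.+1 s ->
  exists a b, [/\ s = a ++ false :: b, dyck_from 0 a & dyck_from h b].
Proof.
have [n] := ubnP (size s); elim: n s h => // n IH [|[] s] h //= Hn Hs.
  have [a [b [Es Ha Hb]]] := IH _ _ Hn Hs.
  have Hbn : size b < n by move: Hn; rewrite Es size_cat /=; lia.
  have [a' [b' [Eb Ha' Hb']]] := IH _ _ Hbn Hb.
  exists (node a a'), b'; split=> //; last exact: dyck_node.
  by rewrite Es Eb /= -catA.
by exists [::], s.
Qed.

Lemma dyck_ind (P : seq bool -> Prop) :
  P [::] ->
  (forall a b, dyck_from 0 a -> dyck_from 0 b -> P a -> P b -> P (node a b)) ->
  forall s, dyck_from 0 s -> P s.
Proof.
move=> P0 PS s; have [n] := ubnP (size s); elim: n s => // n IH [|[] s] //= Hn.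
move=> /dyck_from_split [a [b [Es Ha Hb]]]; move: Hn; rewrite Es size_cat /= => Hn.
by apply: PS => //; apply: IH => //; lia.
Qed.

(** Both [a] and [a'] end at height 0 without having gone below it, so the [D] that follows is in
    either reading the first step below the axis: the cut is unique. *)
Lemma cat_dyck_inj k a a' b b' :
  dyck_from k a -> dyck_from k a' ->
  a ++ false :: b = a' ++ false :: b' -> a = a' /\ b = b'.
Proof.
elim: a a' k => [|x a IH] [|x' a'] k.
- by move=> _ _ [].
- by case: k => [|k] //; case: x'.
- by case: k => [|k] //; case: x.
case: k => [|k]; case: x; case: x' => //= Ha Ha' [] E;
  by have [-> ->] := IH _ _ Ha Ha' E.
Qed.

Lemma size_node a b : size (node a b) = (size a + size b).+2.
Proof. by rewrite /= size_cat /= addnS. Qed.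

(** * Enumeration of Dyck words by first return *)

Definition dyck_words n : seq (seq bool) := [seq val P | P in Dyck n].

Lemma mem_dyck_words n s : (s \in dyck_words n) = is_dyck n s.
Proof.
apply/imageP/idP => [[P]|Hs]; first by rewrite inE => HP ->.
have Hz : size s == n.*2 by move: Hs; rewrite is_dyckE => /andP[].
by exists (Tuple Hz) => //; rewrite inE.
Qed.

Lemma uniq_dyck_words n : uniq (dyck_words n).
Proof. by rewrite map_inj_uniq ?enum_uniq //; exact: val_inj. Qed.

Lemma dyck_words_rec n :
  perm_eq (dyck_words n.+1)
    (flatten [seq [seq node a b | a <- dyck_words i, b <- dyck_words (n - i)]
             | i <- iota 0 n.+1]).
Proof.
apply: uniq_perm; first exact: uniq_dyck_words.
  (* Regrouping the pair [(a, b)] lets a single injectivity argument treat all [i] at once; [i] is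
     recovered from the length of [a]. *)
  have -> : flatten [seq [seq node a b
                           | a <- dyck_words i, b <- dyck_words (n - i)]
                    | i <- iota 0 n.+1] =
            [seq node p.1 p.2
            | i <- iota 0 n.+1,
              p <- [seq (a, b) | a <- dyck_words i, b <- dyck_words (n - i)]].
    by congr flatten; apply: eq_map => i; rewrite map_allpairs.
  apply: allpairs_uniq_dep; first exact: iota_uniq.
    move=> i _; apply: allpairs_uniq; [exact: uniq_dyck_words..|by case=> ? ? [? ?]].
  move=> u v /allpairsPdep[i [p [_ Hp ->]]] /allpairsPdep[j [p' [_ Hp' ->]]] /=.
  move: Hp => /allpairsP [[a b] /= [Ha Hb ->]].
  move: Hp' => /allpairsP [[a' b'] /= [Ha' Hb' ->]] /=.
  move: Ha Ha'; rewrite !mem_dyck_words !is_dyckE.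
  move=> /andP[/eqP Sa Da] /andP[/eqP Sa' Da'] [] E.
  have [Ea Eb] := cat_dyck_inj Da Da' E.
  have Eij : i = j by apply: double_inj; rewrite -Sa -Sa' Ea.
  by rewrite Ea Eb Eij.
move=> s; rewrite mem_dyck_words is_dyckE; apply/andP/flatten_mapP.
  move=> [/eqP Hs Hd]; case: s Hs Hd => [|[] s] // Hs.
  move=> /(@dyck_from_split 0) [a [b [Es Ha Hb]]].
  have Ea := size_nb a; have Eb := size_nb b.
  have Ca := dyck_from_nb Ha; have Cb := dyck_from_nb Hb.
  move: Hs; rewrite /= Es size_cat /= => Hs.
  exists (nb true a); first by rewrite -[_ :: _]/(iota 0 n.+1) mem_iota; lia.
  by apply: (allpairs_f node); rewrite mem_dyck_words is_dyckE ?Ha ?Hb andbT;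
    apply/eqP; lia.
move=> [i]; rewrite mem_iota => Hi /allpairsP [[a b] /= []].
rewrite !mem_dyck_words !is_dyckE => /andP[/eqP Sa Da] /andP[/eqP Sb Db] ->.
split; last exact: dyck_node.
by rewrite size_node Sa Sb; lia.
Qed.

Lemma big_dyck_words (V : nmodType) n (f : seq bool -> V) :
  (\sum_(P in Dyck n) f P = \sum_(s <- dyck_words n) f s)%R.
Proof. by rewrite big_map big_enum. Qed.

Lemma big_dyck_words0 (V : nmodType) (f : seq bool -> V) :
  (\sum_(s <- dyck_words 0) f s = f [::])%R.
Proof.
have E : perm_eq (dyck_words 0) [:: [::]].
  apply: uniq_perm => //; first exact: uniq_dyck_words.
  by move=> s; rewrite mem_dyck_words is_dyckE inE; case: s => [|[] []].
by rewrite (perm_big _ E) big_seq1.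
Qed.

Lemma big_dyck_wordsS (V : nmodType) n (f : seq bool -> V) :
  (\sum_(s <- dyck_words n.+1) f s =
   \sum_(i < n.+1) \sum_(a <- dyck_words i) \sum_(b <- dyck_words (n - i))
      f (node a b))%R.
Proof.
rewrite (perm_big _ (dyck_words_rec n)) big_flatten big_map.
rewrite -[iota _ _]/(index_iota 0 n.+1).
rewrite big_mkord; apply: eq_bigr => i _.
by rewrite big_allpairs_dep.
Qed.

(** * Statistics of U A D B *)

Lemma heightE s x : height s x = nb true (take x s) - nb false (take x s).
Proof. by []. Qed.

Lemma height0 s : height s 0 = 0.
Proof. by rewrite heightE take0. Qed.

Lemma height_nodeL a b y :
  dyck_from 0 a -> y <= size a -> height (node a b) y.+1 = (height a y).+1.
Proof.
move=> Ha Hy; rewrite !heightE /= takel_cat // !nb_cons.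
(* The prefix inequality keeps the truncated subtraction in [height] exact. *)
by have := dyck_from_prefix y Ha; lia.
Qed.

Lemma height_nodeR a b y :
  dyck_from 0 a -> height (node a b) ((size a).+2 + y) = height b y.
Proof.
move=> Ha; have := dyck_from_nb Ha.
rewrite !heightE addSn /= take_cat.
have -> : ((size a).+1 + y < size a) = false by lia.
have -> : (size a).+1 + y - size a = y.+1 by lia.
rewrite /= !nb_cons !nb_cat !nb_cons; lia.
Qed.

Lemma nth_nodeL a b y : y < size a -> nth false (node a b) y.+1 = nth false a y.
Proof. by move=> Hy; rewrite /= nth_cat Hy. Qed.

Lemma nth_nodeM a b : nth false (node a b) (size a).+1 = false.
Proof. by rewrite /= nth_cat ltnn subnn. Qed.

Lemma nth_nodeR a b y : nth false (node a b) ((size a).+2 + y) = nth false b y.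
Proof.
rewrite addSn /= nth_cat.
have -> : ((size a).+1 + y < size a) = false by lia.
by have -> : (size a).+1 + y - size a = y.+1 by lia.
Qed.

Lemma dyck_head s : dyck_from 0 s -> 0 < size s -> nth false s 0 = true.
Proof. by case: s => [|[] s]. Qed.

Lemma dyck_last s : dyck_from 0 s -> nth false s (size s).-1 = false.
Proof.
move: s; apply: dyck_ind => // a [|c b] Ha Hb _ IH; rewrite size_node.
  by rewrite addn0 nth_nodeM.
have -> : (size a + size (c :: b)).+2.-1 = (size a).+2 + (size (c :: b)).-1.
  by rewrite /=; lia.
by rewrite nth_nodeR.
Qed.

Lemma is_peak_nodeL a b y : dyck_from 0 a -> y < size a ->
  is_peak (node a b) y.+1 = is_peak a y.
Proof.
move=> Ha Hy; rewrite /is_peak size_node nth_nodeL // Hy.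
have -> : y.+1 < (size a + size b).+2 by lia.
(* At [y = 0] the node supplies a preceding [U], but a nonempty [a] starts with [U], so no peak
   arises. *)
case: y Hy => [|y] Hy; first by rewrite dyck_head // andbF.
by rewrite !succnK nth_nodeL // ltnW.
Qed.

Lemma is_valley_nodeL a b y : dyck_from 0 a -> y < size a ->
  is_valley (node a b) y.+1 = is_valley a y.
Proof.
move=> Ha Hy; rewrite /is_valley size_node nth_nodeL // Hy.
have -> : y.+1 < (size a + size b).+2 by lia.
case: y Hy => [|y] Hy //.
by rewrite !succnK nth_nodeL // ltnW.
Qed.

(** A nonempty Dyck word ends with [D], so the closing [D] follows a [U] only when that [U] is the
    opening one. *)
Lemma is_peak_nodeM a b : dyck_from 0 a ->
  is_peak (node a b) (size a).+1 = (size a == 0).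
Proof.
move=> Ha; rewrite /is_peak size_node nth_nodeM eqxx andbT.
have -> : (size a).+1 < (size a + size b).+2 by lia.
rewrite succnK /=.
have := dyck_last Ha; case Ea : (size a) => [|m] //= Hm.
by rewrite nth_cat Ea ltnSn Hm.
Qed.

Lemma is_valley_nodeM a b : is_valley (node a b) (size a).+1 = false.
Proof. by rewrite /is_valley nth_nodeM !andbF. Qed.

Lemma is_peak_nodeR a b y : y < size b ->
  is_peak (node a b) ((size a).+2 + y) = is_peak b y.
Proof.
move=> Hy; rewrite /is_peak size_node nth_nodeR Hy.
have -> : (size a).+2 + y < (size a + size b).+2 by lia.
case: y Hy => [|y] Hy; first by rewrite addn0 succnK nth_nodeM.
by rewrite addnS !succnK nth_nodeR.
Qed.

Lemma is_valley_nodeR a b y : dyck_from 0 b -> y < size b ->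
  is_valley (node a b) ((size a).+2 + y) = (y == 0) || is_valley b y.
Proof.
move=> Hb Hy; rewrite /is_valley size_node nth_nodeR Hy.
have -> : (size a).+2 + y < (size a + size b).+2 by lia.
case: y Hy => [|y] Hy; first by rewrite addn0 succnK nth_nodeM dyck_head.
by rewrite addnS !succnK nth_nodeR.
Qed.

(** Ensures that [height - 1] is a true subtraction, so that lifting a path by one level adds
    exactly 1 per peak. *)
Lemma peak_height_gt0 s x : dyck_from 0 s -> is_peak s x -> 0 < height s x.
Proof.
move=> Hs /and4P[x0 xs /eqP Hx _]; have := dyck_from_prefix x.-1 Hs.
case: x x0 xs Hx => // x _ xs; rewrite succnK => Hx.
rewrite heightE (take_nth false) ?(ltnW xs) // Hx -cats1 !nb_cat !nb_cons !nb_nil; lia.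
Qed.

(** * Tunnels of valleys *)

(** A certificate for the maximum in [tunnel_start]: it excludes the default value 0 of an empty
    maximum and is easily transported into [node a b]. *)
Definition is_tunnel s x y :=
  [/\ y < x, height s y = height s x &
      forall z, y < z < x -> height s z <> height s x].

Lemma tunnel_startE s x y : is_tunnel s x y -> tunnel_start s x = y.
Proof.
move=> [yx Hy Hz]; apply/eqP; rewrite eqn_leq; apply/andP; split.
  apply/bigmax_leqP => z /eqP Ez; rewrite leqNgt; apply/negP => yz.
  by apply: (Hz z) => //; rewrite yz ltn_ord.
by apply: (leq_bigmax_cond (Ordinal yx)); rewrite /= Hy.
Qed.

Lemma is_tunnel_nodeL a b x y : dyck_from 0 a -> x < size a ->
  is_tunnel a x y -> is_tunnel (node a b) x.+1 y.+1.
Proof.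
move=> Ha Hx [yx Hy Hz]; split=> //; first by rewrite !height_nodeL ?Hy //; lia.
move=> [|z] // Hyz; rewrite !height_nodeL //; try lia.
by case; apply: Hz.
Qed.

Lemma is_tunnel_nodeR a b x y : dyck_from 0 a ->
  is_tunnel b x y -> is_tunnel (node a b) ((size a).+2 + x) ((size a).+2 + y).
Proof.
move=> Ha [yx Hy Hz]; split; [lia|by rewrite !height_nodeR|].
move=> z Hyz; have -> : z = (size a).+2 + (z - (size a).+2) by lia.
by rewrite !height_nodeR //; apply: Hz; lia.
Qed.

(** Strictly between its endpoints [U A D] stays above the axis, so the previous visit to height 0
    is the origin. *)
Lemma is_tunnel_nodeM a b : dyck_from 0 a -> is_tunnel (node a b) (size a).+2 0.
Proof.
move=> Ha; have E : height (node a b) (size a).+2 = 0.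
  by have := height_nodeR b 0 Ha; rewrite addn0 height0.
by split; rewrite ?E // => -[|z] // Hz; rewrite height_nodeL //; lia.
Qed.

Lemma valley_tunnel s x : dyck_from 0 s -> is_valley s x -> exists y, is_tunnel s x y.
Proof.
move=> Hs; move: s Hs x; apply: dyck_ind => [[]//|a b Ha Hb IHa IHb [|x] // Hv].
have Hx : x.+1 < size (node a b) by case/and4P: Hv.
have [xa|xa] := ltnP x (size a).
  move: Hv; rewrite is_valley_nodeL // => /IHa [y Hy].
  by exists y.+1; apply: is_tunnel_nodeL.
have [Ex|Ex] := eqVneq x (size a); first by rewrite Ex is_valley_nodeM in Hv.
have E : x.+1 = (size a).+2 + (x - (size a).+1) by lia.
move: Hv Hx; rewrite E size_node => Hv Hx.
have [Ey|Ey] := eqVneq (x - (size a).+1) 0.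
  by exists 0; rewrite Ey addn0; apply: is_tunnel_nodeM.
move: Hv; rewrite is_valley_nodeR // ?(negbTE Ey) /=; last lia.
by move=> /IHb [y Hy]; exists ((size a).+2 + y); apply: is_tunnel_nodeR.
Qed.

Lemma tunnel_semilength_nodeL a b x : dyck_from 0 a -> is_valley a x ->
  tunnel_semilength (node a b) x.+1 = tunnel_semilength a x.
Proof.
move=> Ha Hv; have [y Hy] := valley_tunnel Ha Hv; have xa : x < size a by case/and4P: Hv.
by rewrite /tunnel_semilength (tunnel_startE Hy) (tunnel_startE (is_tunnel_nodeL b Ha xa Hy)) subSS.
Qed.

Lemma tunnel_semilength_nodeR a b x :
  dyck_from 0 a -> dyck_from 0 b -> is_valley b x ->
  tunnel_semilength (node a b) ((size a).+2 + x) = tunnel_semilength b x.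
Proof.
move=> Ha Hb Hv; have [y Hy] := valley_tunnel Hb Hv.
by rewrite /tunnel_semilength (tunnel_startE Hy) (tunnel_startE (is_tunnel_nodeR Ha Hy)) subnDl.
Qed.

Lemma tunnel_semilength_nodeM a b : dyck_from 0 a ->
  tunnel_semilength (node a b) (size a).+2 = (size a)./2.+1.
Proof. by move=> Ha; rewrite /tunnel_semilength (tunnel_startE (is_tunnel_nodeM b Ha)) subn0. Qed.

(** The abscissa [(size a).+2] of the first return is counted with [b], as [y = 0]; the valley
    created there when [b] is nonempty is not a valley of [b] itself. *)
Lemma big_node a b (F : nat -> nat) :
  \sum_(x < size (node a b)) F x =
  F 0 + \sum_(y < size a) F y.+1 + F (size a).+1
    + \sum_(y < size b) F ((size a).+2 + y).
Proof.
rewrite size_node -(big_mkord xpredT) big_nat_recl // -addnA -addnA; congr (_ + _).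
rewrite (big_cat_nat (n := size a)) //=; last lia.
congr (_ + _); first by rewrite big_mkord.
rewrite big_ltn; last lia.
congr (_ + _); rewrite -{1}[(size a).+1]add0n big_addn.
have -> : (size a + size b).+1 - (size a).+1 = size b by lia.
by rewrite big_mkord; apply: eq_bigr => i _; congr F; lia.
Qed.

Lemma big_peaks_node a b (G : nat -> nat) : dyck_from 0 a ->
  \sum_(x < size (node a b) | is_peak (node a b) x) G x =
  \sum_(y < size a | is_peak a y) G y.+1 + (size a == 0) * G 1
    + \sum_(y < size b | is_peak b y) G ((size a).+2 + y).
Proof.
move=> Ha; rewrite big_mkcond (big_node a b (fun x => if is_peak (node a b) x then G x else 0)).
rewrite add0n is_peak_nodeM //; congr (_ + _ + _).
- by rewrite [RHS]big_mkcond; apply: eq_bigr => y _; rewrite is_peak_nodeL.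
- by case: eqP => [->|]; rewrite ?mul1n.
- by rewrite [RHS]big_mkcond; apply: eq_bigr => y _; rewrite is_peak_nodeR.
Qed.

Lemma big_valleys_node a b (G : nat -> nat) : dyck_from 0 a -> dyck_from 0 b ->
  \sum_(x < size (node a b) | is_valley (node a b) x) G x =
  \sum_(y < size a | is_valley a y) G y.+1 + (size b != 0) * G (size a).+2
    + \sum_(y < size b | is_valley b y) G ((size a).+2 + y).
Proof.
move=> Ha Hb; rewrite big_mkcond (big_node a b (fun x => if is_valley (node a b) x then G x else 0)).
rewrite add0n is_valley_nodeM // addn0 -addnA; congr (_ + _).
  by rewrite [RHS]big_mkcond; apply: eq_bigr => y _; rewrite is_valley_nodeL.
rewrite [in RHS]big_mkcond.
transitivity (\sum_(y < size b)
    if (y == 0 :> nat) || is_valley b y then G ((size a).+2 + y) else 0).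
  by apply: eq_bigr => y _; rewrite is_valley_nodeR.
case: (size b) => [|m]; first by rewrite !big_ord0.
by rewrite !big_ord_recl /= addn0 mul1n.
Qed.

Lemma npeaks_node a b : dyck_from 0 a ->
  npeaks (node a b) = npeaks a + (size a == 0) + npeaks b.
Proof. by move=> Ha; rewrite /npeaks (big_peaks_node b (fun=> 1)) // muln1. Qed.

(** Each peak of [a] is lifted by one, which is the source of the substitution of [q * t] for [t];
    the peak created by an empty [a] has height 1 and contributes 0. *)
Lemma speaks_node a b : dyck_from 0 a ->
  speaks (node a b) = speaks a + npeaks a + speaks b.
Proof.
move=> Ha; rewrite /speaks (big_peaks_node b (fun x => height (node a b) x - 1)) //.
rewrite height_nodeL // height0 muln0 addn0 /npeaks -big_split /=.
congr (_ + _); apply: eq_bigr => y Hy; last by rewrite height_nodeR.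
have := peak_height_gt0 Ha Hy; have := ltn_ord y => ya.
by rewrite height_nodeL ?(ltnW ya) //; lia.
Qed.

Lemma des_node a b : dyck_from 0 a -> dyck_from 0 b ->
  des (node a b) = des a + (size b != 0) + des b.
Proof. by move=> Ha Hb; rewrite /des (big_valleys_node (fun=> 1)) // muln1. Qed.

Lemma stunnels_node a b : dyck_from 0 a -> dyck_from 0 b ->
  stunnels (node a b) = stunnels a + (size b != 0) * (size a)./2.+1 + stunnels b.
Proof.
move=> Ha Hb; rewrite /stunnels (big_valleys_node (tunnel_semilength (node a b))) //.
rewrite tunnel_semilength_nodeM //; congr (_ + _ + _); apply: eq_bigr => y Hy.
  by rewrite tunnel_semilength_nodeL.
by rewrite tunnel_semilength_nodeR.
Qed.

Lemma stats_nil : [/\ npeaks [::] = 0, speaks [::] = 0, des [::] = 0 & stunnels [::] = 0].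
Proof. by split; apply: big_ord0. Qed.

(** Lets the truncated exponent [n - des] split additively over [node]. *)
Lemma des_le s : dyck_from 0 s -> des s <= (size s)./2.
Proof.
move: s; apply: dyck_ind => [|a b Ha Hb IHa IHb]; first by have [_ _ ->] := stats_nil.
rewrite des_node // size_node; lia.
Qed.

(** * The functional equations *)

Import GRing.Theory.
Local Open Scope ring_scope.

(** Power series in x are represented modulo ['X^N]; every series identity below carries an explicit
    multiple of ['X^N]. *)
Definition tpoly (K : comNzRingType) N (u : nat -> K) : {poly K} := \poly_(i < N) u i.

Lemma poly_vanish (K : comNzRingType) N (p : {poly K}) :
  (forall k, (k < N)%N -> p`_k = 0) -> exists e, p = e * 'X^N.
Proof.
move=> Hp; exists (drop_poly N p); rewrite -[LHS](poly_take_drop N).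
rewrite [take_poly _ _](_ : _ = 0) ?add0r //.
by apply/polyP => k; rewrite coef_take_poly coef0; case: ltnP => // /Hp.
Qed.

(* The coefficients in x of the equation
   R(x,t) = 1 + x t R(x,t) + x q R(q x,t) (R(x,t) - 1). *)
Definition valley_rec (K : comNzRingType) (q t : K) (a : nat -> K) :=
  a 0 = 1 /\ forall n, a n.+1 = t * a n +
     \sum_(i < n.+1) q ^+ i.+1 * a i * (a (n - i)%N - (n - i == 0)%N%:R).

(** The equation for R with x replaced by q^m x, which multiplies coefficient [i] by
    [q ^+ (m * i)]. *)
Lemma valley_series (K : comNzRingType) (q t : K) N (a : nat -> K) (m : nat) :
  valley_rec q t a ->
  exists e, tpoly N (fun i => q ^+ (m * i) * a i)
    = 1 + 'X * (q ^+ m * t)%:P * tpoly N (fun i => q ^+ (m * i) * a i)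
      + 'X * (q ^+ m.+1)%:P * tpoly N (fun i => q ^+ (m.+1 * i) * a i)
          * (tpoly N (fun i => q ^+ (m * i) * a i) - 1) + e * 'X^N.
Proof.
move=> [a0 aS].
set A := tpoly _ _; set C := tpoly _ _.
suff [e He] : exists e, A - (1 + 'X * (q ^+ m * t)%:P * A
    + 'X * (q ^+ m.+1)%:P * C * (A - 1)) = e * 'X^N.
  by exists e; rewrite -He; ring.
apply: poly_vanish => k Hk.
rewrite coefB !coefD -!mulrA !coefXM coef1 /A coef_poly Hk.
case: k Hk => [|k] Hk /=; first by rewrite muln0 a0; ring.
rewrite !coefCM coefM coef_poly ltnW // aS big_distrr /=.
apply/eqP; rewrite subr_eq0; apply/eqP.
rewrite mulrDr add0r; congr (_ + _).
  by rewrite mulnS exprD; ring.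
rewrite mulr_sumr; apply: eq_bigr => i _.
have Hi := ltn_ord i.
rewrite coefB coef1 !coef_poly.
have -> : (i < N)%N by lia.
have -> : (k - i < N)%N by lia.
have Ek : (m * k.+1 = m + m * i + m * (k - i))%N by nia.
rewrite Ek mulSn !exprD; case: eqP => [->|_]; rewrite ?muln0 !exprS; rewrite ?muln0 ?expr0 /=; ring.
Qed.

(** The conclusion is the equation of L, read for R: [a] stands for R(x,t) and [b] for R(x,qt). *)
Lemma valley_peak_series (K : comNzRingType) (q t : K) (a b : nat -> K) :
  valley_rec q t a -> valley_rec q (q * t) b ->
  forall n, a n.+1 = t * a n + \sum_(i < n.+1) (b i - (i == 0 :> nat)%:R) * a (n - i)%N.
Proof.
(* With this [N] the coefficients up to [n.+1] are exact. *)
move=> Ha Hb n; set N := n.+2.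
have [h1 E1] := valley_series N 0 Ha.
have [h3 E3] := valley_series N 1 Ha.
have [h2 E2] := valley_series N 0 Hb.
move: E1 E2 E3.
set A := tpoly N (fun i => q ^+ (0 * i) * a i).
set B := tpoly N (fun i => q ^+ (0 * i) * b i).
set C := tpoly N (fun i => q ^+ (1 * i) * a i).
set E := tpoly N (fun i => q ^+ (1 * i) * b i).
set F := tpoly N (fun i => q ^+ (2 * i) * a i).
rewrite !expr0 !expr1 !mul1r !polyCM ?polyC_exp => E1 E2 E3.
(* With x = 'X, these stand for A = R(x,t), B = R(x,qt), C = R(qx,t),
   E = R(qx,qt), F = R(q^2 x,t), and D' for D(qx). *)
pose D := (B - 1) * A - q%:P * C * (A - 1).
pose D' := (E - 1) * C - q%:P * F * (C - 1).
(* The three equations are combined with multipliers [A * C], [- A * (B - 1)] and [- q C]: the terms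
   free of x add up to [D], and those containing [t] cancel. *)
have ED : D = 'X * (q%:P * C * D + q%:P * A * (B - 1) * D')
   + (A * C * h2 - A * (B - 1) * h3 - q%:P * C * h1) * 'X^N.
  have F1 : h1 * 'X^N = A - (1 + 'X * t%:P * A
     + 'X * q%:P * C * (A - 1)).
    by rewrite {1}E1; ring.
  have F2 : h2 * 'X^N = B - (1 + 'X * (q%:P * t%:P) * B
     + 'X * q%:P * E * (B - 1)).
    by rewrite {1}E2; ring.
  have F3 : h3 * 'X^N = C - (1 + 'X * (q%:P * t%:P) * C
     + 'X * q%:P ^+ 2 * F * (C - 1)).
    by rewrite {1}E3; ring.
  transitivity ('X * (q%:P * C * D + q%:P * A * (B - 1) * D')
     + (A * C * (h2 * 'X^N) - A * (B - 1) * (h3 * 'X^N) - q%:P * C * (h1 * 'X^N))).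
    by rewrite F1 F2 F3 /D /D'; ring.
  by rewrite /D /D'; ring.
have D'E k : (k < N)%N -> D'`_k = q ^+ k * D`_k.
  move=> Hk; rewrite /D /D' !coefB -!mulrA !coefCM !coefM.
  rewrite mulrBr !mulr_sumr; congr (_ - _); apply: eq_bigr => i _;
   have Hi := ltn_ord i; rewrite !coefB !coef1 !coef_poly;
   (have -> : (i < N)%N by lia); (have -> : (k - i < N)%N by lia);
   rewrite -[in q ^+ k](subnKC (n := k) (m := i)) ?exprD ?mul0n ?mul1n ?mul2n -?addnn ?exprD ?expr0; try lia.
    by case: (i : nat) => [|j] /=; rewrite ?expr0; ring.
  by case: (k - i)%N => [|j] /=; rewrite ?expr0; ring.
(* The factor ['X] in [ED] expresses coefficient [k] of [D] through strictly smaller coefficients of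
   [D] and [D']. *)
have D0 k : (k < N)%N -> D`_k = 0.
  elim/ltn_ind: k => k IH Hk; rewrite ED coefD coefMXn Hk addr0 coefXM.
  case: eqP => // /eqP k0; rewrite coefD !coefM !big1 ?addr0 // => i _; have Hi := ltn_ord i.
    by rewrite D'E ?IH ?mulr0 //; lia.
  by rewrite IH ?mulr0 //; lia.
have Dn0 := D0 n (ltnW (ltnSn _)).
(* Replacing [q C (A - 1)] by [(B - 1) A - D] turns the equation of R into that of L, with defect
   [D]. *)
have /(congr1 (fun p : {poly K} => p`_n.+1)) : A = 1 + 'X * (t%:P * A + (B - 1) * A - D) + h1 * 'X^N.
  by rewrite {1}E1 /D; ring.
rewrite !coefD coefMXn ltnSn addr0 coef1 coefXM /= add0r [(_ - D)`_n]coefB => EA.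
move: EA; rewrite Dn0 subr0 coefD coefCM coefM !coef_poly ltnSn ltnW ?ltnSn //.
rewrite !mul0n !mul1r => ->; congr (_ + _); apply: eq_bigr => i _.
have Hi := ltn_ord i.
rewrite coefB coef1 !coef_poly.
have -> : (i < N)%N by lia.
have -> : (n - i < N)%N by lia.
by rewrite !mul0n !mul1r.
Qed.

(** * Recurrences for the two generating functions *)

(** The coefficient of x^n in L. Here [q] and [t] are arbitrary ring elements, so that [t] can be
    specialised to [q * t]. *)
Definition peak_gf (K : comNzRingType) (q t : K) n : K :=
  \sum_(s <- dyck_words n) q ^+ speaks s * t ^+ npeaks s.

Definition valley_gf (K : comNzRingType) (q t : K) n : K :=
  \sum_(s <- dyck_words n) q ^+ stunnels s * t ^+ (n - des s)%N.

Lemma dyck_wordsP n s : s \in dyck_words n -> dyck_from 0 s /\ size s = n.*2.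
Proof. by rewrite mem_dyck_words is_dyckE => /andP[/eqP]. Qed.

Lemma peak_gf0 (K : comNzRingType) (q t : K) : peak_gf q t 0 = 1.
Proof.
by rewrite /peak_gf big_dyck_words0; have [-> -> _ _] := stats_nil; rewrite !expr0 mulr1.
Qed.

Lemma valley_gf0 (K : comNzRingType) (q t : K) : valley_gf q t 0 = 1.
Proof.
by rewrite /valley_gf big_dyck_words0; have [_ _ _ ->] := stats_nil; rewrite !expr0 mulr1.
Qed.

Lemma peak_gfS (K : comNzRingType) (q t : K) n :
  peak_gf q t n.+1 = t * peak_gf q t n +
    \sum_(i < n.+1) (peak_gf q (q * t) i - (i == 0 :> nat)%:R) * peak_gf q t (n - i)%N.
Proof.
(* An empty [a] creates a peak of weight [t] in place of 1, hence the correction [t - 1] at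
   [i = 0]. *)
transitivity (\sum_(i < n.+1)
    (peak_gf q (q * t) i + (i == 0 :> nat)%:R * (t - 1))
    * peak_gf q t (n - i)%N); last first.
  rewrite !big_ord_recl /= subn0 peak_gf0 mul1r mulr1n subrr !mul0r add0r.
  congr (_ + _); first by ring.
  by apply: eq_bigr => i _; rewrite subr0 addr0.
rewrite {1}/peak_gf big_dyck_wordsS; apply: eq_bigr => i _.
case: i => -[|i] Hi /=.
  rewrite big_dyck_words0 peak_gf0 mulr1n mul1r addrC subrK /peak_gf mulr_sumr; apply: eq_bigr => b _.
  rewrite npeaks_node // speaks_node //; have [-> -> _ _] := stats_nil.
  by rewrite !add0n exprS; ring.
rewrite mulr0n mul0r addr0 /peak_gf mulr_suml.
apply: eq_big_seq => a /dyck_wordsP[Ha Sa].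
rewrite mulr_sumr; apply: eq_big_seq => b /dyck_wordsP[Hb Sb].
by rewrite npeaks_node // speaks_node // Sa addn0 !exprD exprMn; ring.
Qed.

Lemma valley_gf_rec (K : comNzRingType) (q t : K) : valley_rec q t (valley_gf q t).
Proof.
split=> [|n]; first exact: valley_gf0.
(* The first summand collects nonempty [b], whose junction valley has a tunnel of semilength [i.+1];
   the second collects empty [b]. *)
transitivity (\sum_(i < n.+1)
    (q ^+ i.+1 * valley_gf q t i
       * (valley_gf q t (n - i)%N - (n - i == 0)%N%:R)
     + (n - i == 0)%N%:R * (t * valley_gf q t i))); last first.
  rewrite big_split addrC; congr (_ + _).
  rewrite big_ord_recr /= subnn mul1r big1 ?add0r // => i _.
  have Hi := ltn_ord i; have -> : (n - i == 0)%N = false by lia.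
  by rewrite mul0r.
rewrite {1}/valley_gf big_dyck_wordsS; apply: eq_bigr => i _.
have Hi := ltn_ord i.
have [Ei|Ei] := eqVneq (n - i)%N 0%N.
  rewrite Ei valley_gf0 subrr mulr0 add0r mul1r mulr_sumr.
  apply: eq_big_seq => a /dyck_wordsP[Ha Sa].
  have := des_le Ha; rewrite Sa doubleK => Da.
  rewrite big_dyck_words0 stunnels_node // des_node //; have [_ _ -> ->] := stats_nil.
  rewrite /= mul0n !addn0.
  (* No valley is created, so the extra unit of semilength yields a factor [t]. *)
  have -> : (n.+1 - des a = (i - des a).+1)%N by lia.
  by rewrite exprS; ring.
rewrite mul0r addr0 subr0 -mulrA mulr_suml mulr_sumr.
apply: eq_big_seq => a /dyck_wordsP[Ha Sa].
rewrite !mulr_sumr; apply: eq_big_seq => b /dyck_wordsP[Hb Sb].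
have := des_le Ha; have := des_le Hb; rewrite Sa Sb !doubleK => Db Da.
rewrite stunnels_node // des_node // Sa Sb doubleK double_eq0 Ei mul1n.
(* Here the junction valley offsets the extra unit of semilength. *)
have -> : (n.+1 - (des a + 1 + des b) = (i - des a) + (n - i - des b))%N by lia.
by rewrite !exprD; ring.
Qed.

(** Both sequences start at 1 and obey the same recurrence; the induction keeps [t] general because
    the recurrence also involves [q * t]. *)
Lemma peak_gf_valley_gf (K : comNzRingType) (q t : K) n : peak_gf q t n = valley_gf q t n.
Proof.
elim/ltn_ind: n t => -[|n] IH t; first by rewrite peak_gf0 valley_gf0.
rewrite peak_gfS (valley_peak_series (valley_gf_rec q t) (valley_gf_rec q (q * t))) IH //.
congr (_ + _); apply: eq_bigr => i _; have Hi := ltn_ord i.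
by rewrite !IH //; lia.
Qed.

Theorem theorem4p2 (n : nat) (hn : (1 <= n)%N) :
  let q : {poly {poly int}} := 'X%:P in
  let t : {poly {poly int}} := 'X in
  \sum_(P in Dyck n) q ^+ speaks P * t ^+ npeaks P
  = \sum_(P in Dyck n) q ^+ stunnels P * t ^+ (n - des P)%N.
Proof.
move=> q t.
rewrite (big_dyck_words n (fun s => q ^+ speaks s * t ^+ npeaks s)).
rewrite (big_dyck_words n (fun s => q ^+ stunnels s * t ^+ (n - des s)%N)).
exact: peak_gf_valley_gf.
Qed.
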